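(* Let $G$ be an Artin-Tits group of spherical type and let $\alpha\in G$. Let $\gamma$ be a conjugate of $\alpha$ such that $CRS(\gamma)$ is standard. Let $P$ be a standard reduction subgroup of $\gamma$. Then $P\in CRS(\gamma)$ if and only if $P^z$ is standard for every $z\in\bigcup_{m\geq 1}Z(\gamma^m)$.
   Context: An Artin-Tits group of spherical type $G$ is given by a finite set $\Sigma$ of standard generators and, for each pair of distinct $s,t\in\Sigma$, a relation $sts\cdots=tst\cdots$ with $m_{s,t}$ letters on each side ($2\le m_{s,t}<\infty$), such that the associated Coxeter group (add the relations $s^2=1$) is finite. Its Dynkin diagram is the graph with vertex set $\Sigma$ where $s,t$ are joined when $m_{s,t}\ge 3$. A positive element is a product of standard generators (possibly empty). $Z(g)$ denotes the centralizer of $g$ in $G$. Conjugation is $g^{h}=h^{-1}gh$, $P^{h}=h^{-1}Ph$; for a set $M$ of subgroups, $M^h=\{P^h : P\in M\}$. A standard parabolic subgroup is a subgroup generated by a subset of $\Sigma$; it is irreducible if the full subgraph of the Dynkin diagram spanned by these generators is connected. An (irreducible) parabolic subgroup is a conjugate of an (irreducible) standard parabolic subgroup; it is proper if it is neither trivial nor $G$. A (nontrivial) irreducible parabolic subgroup $P$ has infinite cyclic center, and $z_P$ denotes its unique generator which is conjugate to a positive element. Two irreducible parabolic subgroups $P,Q$ are adjacent if $z_Pz_Q=z_Qz_P$. The complex of irreducible parabolic subgroups $\mathcal{C}(G)$ is the simplicial complex whose simplices are the finite sets of pairwise adjacent proper irreducible parabolic subgroups (the empty set is a simplex of dimension $-1$).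 A simplex is standard if all its vertices are standard parabolic subgroups. The orbit of $P$ under $\alpha$ is $\{P^{\alpha^i}: i\in\mathbb{Z}\}$. A reduction simplex of $\alpha$ is a simplex $M$ of $\mathcal{C}(G)$ with $M^\alpha=M$; a reduction subgroup of $\alpha$ is a vertex of a reduction simplex of $\alpha$ (equivalently, a proper irreducible parabolic subgroup whose orbit under $\alpha$ is a simplex). A reduction subgroup of $\alpha$ is essential if it is adjacent to every proper irreducible parabolic subgroup whose orbit under $\alpha$ is finite. The canonical reduction system $CRS(\alpha)$ is the set of essential reduction subgroups of $\alpha$; it is a simplex of $\mathcal{C}(G)$. *)

(* Defs.v *)
From mathcomp Require Import all_boot fingroup.
From mathcomp Require Import boolp classical_sets cardinality.
Set Implicit Arguments.
Unset Strict Implicit.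
Unset Printing Implicit Defensive.
Local Open Scope classical_set_scope.
Local Open Scope group_scope.

(* [x ^ h] is [h^-1 * x * h]; subsets and subgroups of a [groupType] [G] are   *)
(* terms of type [set G].                                                     *)

(* Group words on [S]; the letter [(s, true)] stands for the inverse of [s].  *)
Definition word (S : Type) : Type := seq (S * bool).

Definition eval_word (S : Type) (G : groupType) (f : S -> G) (w : word S) : G :=
  \prod_(x <- w) (if x.2 then (f x.1)^-1 else f x.1).

Definition pos_word (S : Type) (l : seq S) : word S := [seq (s, false) | s <- l].

(* Equality in the group with generators [S] and relations [u = v], [R u v].  *)
Inductive word_eq (S : Type) (R : word S -> word S -> Prop) :
    word S -> word S -> Prop :=
| word_eq_refl u : word_eq R u u
| word_eq_sym u v : word_eq R u v -> word_eq R v u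
| word_eq_trans u v w : word_eq R u v -> word_eq R v w -> word_eq R u w
| word_eq_cat u u' v v' :
    word_eq R u u' -> word_eq R v v' -> word_eq R (u ++ v) (u' ++ v')
| word_eq_cancel s b : word_eq R [:: (s, b); (s, ~~ b)] [::]
| word_eq_rel u v : R u v -> word_eq R u v.

(* [f] identifies [G] with the group presented by [S] and [R].                *)
Definition presents (S : Type) (R : word S -> word S -> Prop)
    (G : groupType) (f : S -> G) : Prop :=
  (forall g : G, exists w, g = eval_word f w) /\
  (forall u v, eval_word f u = eval_word f v <-> word_eq R u v).

(* The word [s t s ...] with [n] letters.                                     *)
Definition alternating (S : Type) (s t : S) (n : nat) : seq S :=
  mkseq (fun i => if odd i then t else s) n.

(* The diagonal values of [m] are never used.                                 *)
Definition coxeter_exponents (S : finType) (m : S -> S -> nat) : Prop :=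
  (forall s t, m s t = m t s) /\ (forall s t, s != t -> (2 <= m s t)%N).

Definition artin_relation (S : finType) (m : S -> S -> nat)
    (u v : word S) : Prop :=
  exists s t, [/\ s != t, u = pos_word (alternating s t (m s t)) &
                  v = pos_word (alternating t s (m s t))].

Definition coxeter_relation (S : finType) (m : S -> S -> nat)
    (u v : word S) : Prop :=
  artin_relation m u v \/ exists s, u = pos_word [:: s; s] /\ v = [::].

Definition finite_coxeter_group (S : finType) (m : S -> S -> nat) : Prop :=
  exists (W : finGroupType) (r : S -> W), presents (coxeter_relation m) r.

Definition artin_tits_spherical (S : finType) (m : S -> S -> nat)
    (G : groupType) (sigma : S -> G) : Prop :=
  [/\ coxeter_exponents m, finite_coxeter_group m &
      presents (artin_relation m) sigma].

Definition positive (S : finType) (G : groupType) (sigma : S -> G) (g : G) :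
    Prop :=
  exists l : seq S, g = \prod_(s <- l) sigma s.

Definition is_subgroup (G : groupType) (H : set G) : Prop :=
  H 1 /\ (forall x y, H x -> H y -> H (x / y)).

Definition generated_by (G : groupType) (A : set G) : set G :=
  smallest (@is_subgroup G) A.

Definition centralizer (G : groupType) (g : G) : set G :=
  [set z | commute z g].

Definition subgroup_center (G : groupType) (P : set G) : set G :=
  [set z | P z /\ forall g, P g -> commute z g].

Definition conj_set (G : groupType) (P : set G) (h : G) : set G :=
  [set g ^ h | g in P].

Definition conj_family (G : groupType) (M : set (set G)) (h : G) :
    set (set G) :=
  [set conj_set P h | P in M].

Definition parabolic_of (S : finType) (G : groupType) (sigma : S -> G)
    (X : {set S}) : set G :=
  generated_by [set sigma s | s in [set` X]].

Definition standard_parabolic (S : finType) (G : groupType) (sigma : S -> G)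
    (P : set G) : Prop :=
  exists X : {set S}, P = parabolic_of sigma X.

Definition dynkin_edge (S : finType) (m : S -> S -> nat) : rel S :=
  [rel s t | (s != t) && (3 <= m s t)%N].

Definition dynkin_connected (S : finType) (m : S -> S -> nat) (X : {set S}) :
    Prop :=
  forall s t, s \in X -> t \in X ->
    connect [rel x y | [&& x \in X, y \in X & dynkin_edge m x y]] s t.

(* The empty set counts as connected, so the trivial subgroup satisfies this; *)
(* it is excluded by [proper_irreducible_parabolic].                          *)
Definition irreducible_parabolic (S : finType) (m : S -> S -> nat)
    (G : groupType) (sigma : S -> G) (P : set G) : Prop :=
  exists (X : {set S}) (h : G),
    dynkin_connected m X /\ P = conj_set (parabolic_of sigma X) h.

Definition proper_irreducible_parabolic (S : finType) (m : S -> S -> nat)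
    (G : groupType) (sigma : S -> G) (P : set G) : Prop :=
  [/\ irreducible_parabolic m sigma P, P <> [set 1] & P <> setT].

(* The element z_P.  When [P] is a nontrivial irreducible parabolic subgroup  *)
(* of an Artin-Tits group of spherical type, exactly one [z] satisfies the    *)
(* condition; the default value [1] is only there to make [zeta] total.       *)
Definition zeta (S : finType) (G : groupType) (sigma : S -> G) (P : set G) : G :=
  xget 1 [set z | subgroup_center P = generated_by [set z] /\
                  exists h, positive sigma (z ^ h)].

Definition adjacent (S : finType) (G : groupType) (sigma : S -> G)
    (P Q : set G) : Prop :=
  commute (zeta sigma P) (zeta sigma Q).

Definition simplex (S : finType) (m : S -> S -> nat) (G : groupType)
    (sigma : S -> G) (M : set (set G)) : Prop :=
  [/\ finite_set M,
      forall P, M P -> proper_irreducible_parabolic m sigma P &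
      forall P Q, M P -> M Q -> adjacent sigma P Q].

Definition standard_family (S : finType) (G : groupType) (sigma : S -> G)
    (M : set (set G)) : Prop :=
  forall P, M P -> standard_parabolic sigma P.

Definition orbit_under (G : groupType) (alpha : G) (P : set G) : set (set G) :=
  [set Q | exists n : nat,
     Q = conj_set P (alpha ^+ n) \/ Q = conj_set P (alpha ^- n)].

Definition reduction_simplex (S : finType) (m : S -> S -> nat) (G : groupType)
    (sigma : S -> G) (alpha : G) (M : set (set G)) : Prop :=
  simplex m sigma M /\ conj_family M alpha = M.

Definition reduction_subgroup (S : finType) (m : S -> S -> nat) (G : groupType)
    (sigma : S -> G) (alpha : G) (P : set G) : Prop :=
  exists M, reduction_simplex m sigma alpha M /\ M P.

Definition essential (S : finType) (m : S -> S -> nat) (G : groupType)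
    (sigma : S -> G) (alpha : G) (P : set G) : Prop :=
  forall Q, proper_irreducible_parabolic m sigma Q ->
    finite_set (orbit_under alpha Q) -> adjacent sigma P Q.

Definition CRS (S : finType) (m : S -> S -> nat) (G : groupType)
    (sigma : S -> G) (alpha : G) : set (set G) :=
  [set P | reduction_subgroup m sigma alpha P /\ essential m sigma alpha P].

(* Main.v *)
(** The Artin group acts on [algC ^ S] by the Burau-type deformation, at [q = 4],
    of the reflection representation: [sigma s] maps [v] to [v + (v u_s) e_s],
    with determinant [-4].  The modulus of the determinant detects which powers
    of an element are conjugate to a positive one, whence [zeta] is equivariant
    under conjugation, and so is everything defined from adjacency.

    Left to right, [CRS gamma] only depends on the subgroups periodic under
    [gamma], so that it is stable under every [z] commuting with a power of
    [gamma].

    Right to left, let [Q] be periodic under [gamma] and let [a] be the central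
    element [z_Q].  All powers of [a] commute with a power of [gamma], so the
    [P ^ (a ^ n)] are standard, and finiteness gives [P ^ (a ^ n) = P] for some
    [n > 0].  By connectedness of its diagram, [Q] only lets its centre act on
    the span of its root vectors by a scalar [l], hence [rho a] is a root of
    [(X - 1) (X - l)]; the determinant shows that [l] is not a root of unity.
    Thus [rho a] is a linear combination of [1] and [rho (a ^ n)] and it
    preserves the span of the root vectors of [P].  Since distinct standard
    parabolics have distinct spans, the standard subgroup [P ^ a] is [P], that
    is, [z_P] and [z_Q] commute.  *)
Require Import Defs.
From mathcomp Require Import all_boot fingroup.
From mathcomp Require Import boolp classical_sets cardinality.
From mathcomp Require Import order ssralg ssrnum poly zmodp matrix mxalgebra.
From mathcomp Require Import algC cyclotomic.
From mathcomp Require Import ring.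
Local Open Scope classical_set_scope.
Local Open Scope group_scope.

(** * Determinants and braid relations of rank-one perturbations of the identity *)

Section LinearAlgebra.
Set Implicit Arguments.
Unset Strict Implicit.
Import GRing.Theory.
Local Open Scope ring_scope.

(** Both sides are the determinant of one block matrix [M], factored as upper times lower and as
    lower times upper triangular. *)
Lemma det_mulmx_add1 (R : comNzRingType) n k (A : 'M[R]_(n, k)) (B : 'M_(k, n)) :
  \det (1%:M + A *m B) = \det (1%:M + B *m A).
Proof.
pose M := block_mx 1%:M A (- B) 1%:M.
have -> : \det (1%:M + A *m B) = \det M.
  have -> : M = block_mx 1%:M A 0 1%:M *m block_mx (1%:M + A *m B) 0 (- B) 1%:M.
    by rewrite mulmx_block !mul1mx !mul0mx !mulmx1 !add0r mulmxN addrK.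
  by rewrite det_mulmx det_ublock det_lblock !det1 !mul1r mulr1.
have -> : M = block_mx 1%:M 0 (- B) 1%:M *m block_mx 1%:M A 0 (1%:M + B *m A).
  by rewrite mulmx_block !mul1mx !mul0mx !mulmx1 !addr0 mulNmx addrC addrK.
by rewrite det_mulmx det_ublock det_lblock !det1 !mul1r.
Qed.

(** In a rank factorization [A = C R], the factor [C] cancels on the left and [R] on the right, so
    [A A = 0] forces [R C = 0], while the determinant is that of [1 + R C]. *)
Lemma det_unipotent (F : fieldType) n (A : 'M[F]_n) :
  A *m A = 0 -> \det (1%:M + A) = 1.
Proof.
move=> A2; rewrite -(mulmx_base A) det_mulmx_add1.
suff -> : row_base A *m col_base A = 0 by rewrite addr0 det1.
apply: (row_free_inj (row_base_free A)); rewrite mul0mx.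
apply: (row_full_inj (col_base_full A)).
transitivity ((col_base A *m row_base A) *m (col_base A *m row_base A)).
  by rewrite !mulmxA.
by rewrite mulmx_base A2 mulmx0.
Qed.

Lemma mul_row_rank1 (R : comNzRingType) n (v e : 'rV[R]_n) (u : 'cV_n) :
  v *m (1%:M + u *m e) = v + (v *m u) 0 0 *: e.
Proof.
by rewrite mulmxDr mulmx1 mulmxA [v *m u]mx11_scalar mul_scalar_mx -mx11_scalar.
Qed.

(* [p] satisfies [p (i + 2) = (c + d) p (i + 1) - c d p i]. *)
Lemma linear_recursion (F : fieldType) (c d : F) (p r : nat -> F) N :
  c != d -> c ^+ N = d ^+ N ->
  (forall i, p i.+1 = r i + (c + d) * p i) ->
  (forall i, r i.+1 = - (c * d) * p i) ->
  p N = c ^+ N * p 0 /\ r N = c ^+ N * r 0.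
Proof.
move=> cd cdN pE rE.
(* The combination [r i + a * p i] is geometric of ratio [a] for either root [a] of the
   characteristic polynomial. The roots being distinct with equal [N]-th powers, the two
   combinations determine [p N] and [r N]. *)
have H a b : (forall i, p i.+1 = r i + (a + b) * p i) ->
    (forall i, r i.+1 = - (a * b) * p i) ->
    forall i, r i + a * p i = a ^+ i * (r 0 + a * p 0).
  move=> h1 h2; elim=> [|i IH]; first by rewrite expr0 mul1r.
  by rewrite exprS -mulrA -IH h1 h2; ring.
have H1 := H c d pE rE N.
have H2 : r N + d * p N = d ^+ N * (r 0 + d * p 0).
  by apply: (H d c) => i; rewrite ?pE ?rE; ring.
rewrite -cdN in H2.
have cd0 : c - d != 0 by rewrite subr_eq0.
have pN : p N = c ^+ N * p 0.
  apply: (mulfI cd0).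
  transitivity ((r N + c * p N) - (r N + d * p N)); first by ring.
  by rewrite H1 H2; ring.
split=> //; move: H1; rewrite pN => H1.
by apply: (addIr (c * (c ^+ N * p 0))); rewrite H1; ring.
Qed.

(** Both products move [v] by a vector of the span of [e] and [f], and they give the same values of
    the functionals [u] and [w]: these are multiplied by [c ^+ N], and exchanged when [N] is odd.
    The condition on [(1 + c * d) ^+ 2] says that [u] and [w] separate the combinations of [e] and
    [f]. *)
Lemma rank1_braid (F : fieldType) n (e f : 'rV[F]_n) (u w : 'cV_n) (c d : F) N :
  c != d -> c ^+ N = d ^+ N ->
  (1 + c * d) ^+ 2 != (c + d) ^+ 2 ->
  e *m u = (- (1 + c * d))%:M -> f *m w = (- (1 + c * d))%:M ->
  e *m w = (c + d)%:M -> f *m u = (c + d)%:M ->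
  let A := 1%:M + u *m e in let B := 1%:M + w *m f in
  \prod_(i < N) (if odd i then B else A) = \prod_(i < N) (if odd i then A else B).
Proof.
move=> cd cdN nd eu fw ew fu A B.
pose phi (x : 'cV_n) (v : 'rV_n) : F := (v *m x) 0 0.
have phiD x v a b :
    phi x (v + a *: e + b *: f) = phi x v + a * phi x e + b * phi x f.
  by rewrite /phi !mulmxDl -!scalemxAl !mxE.
have [phiue phiwf] : phi u e = - (1 + c * d) /\ phi w f = - (1 + c * d).
  by rewrite /phi eu fw !mxE eqxx.
have [phiwe phiuf] : phi w e = c + d /\ phi u f = c + d.
  by rewrite /phi ew fu !mxE eqxx.
have key e1 f1 u1 w1 (X := fun i : nat =>
      if odd i then 1%:M + w1 *m f1 else 1%:M + u1 *m e1) :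
    phi u1 e1 = - (1 + c * d) -> phi w1 f1 = - (1 + c * d) ->
    phi w1 e1 = c + d -> phi u1 f1 = c + d ->
    forall v : 'rV_n, let v' := v *m \prod_(i < N) X i in
    (exists a b, v' = v + a *: e1 + b *: f1) /\
    (if odd N then phi w1 v' else phi u1 v') = c ^+ N * phi u1 v /\
    (if odd N then phi u1 v' else phi w1 v') = c ^+ N * phi w1 v.
  move=> h1 h2 h3 h4 v /=.
  pose x k := v *m \prod_(i < k) X i.
  have xS k : x k.+1 = x k *m X k.
    by rewrite /x big_ord_recr /= mulmxA.
  have phiZ t (y z : 'rV_n) a : phi t (y + a *: z) = phi t y + a * phi t z.
    by rewrite /phi mulmxDl -scalemxAl !mxE.
  split.
    rewrite -/(x N); elim: N {cdN} => [|k [a [b IH]]].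
      by exists 0, 0; rewrite /x big_ord0 mulmx1 !scale0r !addr0.
    rewrite xS IH /X; case: (odd k); rewrite mul_row_rank1.
      exists a, (b + ((v + a *: e1 + b *: f1) *m w1) 0 0).
      by rewrite scalerDl addrA.
    exists (a + ((v + a *: e1 + b *: f1) *m u1) 0 0), b.
    by rewrite scalerDl addrAC addrA.
  (* [p k] is the value of the functional that the next factor [X k] uses, and [r k] that of the
     other one. *)
  pose p k := if odd k then phi w1 (x k) else phi u1 (x k).
  pose r k := if odd k then phi u1 (x k) else phi w1 (x k).
  have pS k : p k.+1 = r k + (c + d) * p k.
    rewrite /p /r xS /X /=; case: (odd k); rewrite /= mul_row_rank1 phiZ -/(phi _ _).
      by rewrite h4; ring.
    by rewrite h3; ring.
  have rS k : r k.+1 = - (c * d) * p k.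
    rewrite /p /r xS /X /=; case: (odd k); rewrite /= mul_row_rank1 phiZ -/(phi _ _).
      by rewrite h2; ring.
    by rewrite h1; ring.
  have [hp hr] := linear_recursion cd cdN pS rS.
  by move: hp hr; rewrite /p /r /= /x big_ord0 !mulmx1.
apply/row_matrixP => i; rewrite !rowE; move: (delta_mx _ _) => v.
have [[a [b E1]] [P1 Q1]] := key e f u w phiue phiwf phiwe phiuf v.
have [[b' [a' E2]] [P2 Q2]] := key f e w u phiwf phiue phiuf phiwe v.
have Eu : phi u (v + a *: e + b *: f) = phi u (v + a' *: e + b' *: f).
  rewrite -E1 [in RHS]addrAC -E2; move: P1 Q1 P2 Q2; rewrite -/A -/B.
  by case: (odd N) => P1 Q1 P2 Q2; rewrite ?P1 ?Q1 ?P2 ?Q2.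
have Ew : phi w (v + a *: e + b *: f) = phi w (v + a' *: e + b' *: f).
  rewrite -E1 [in RHS]addrAC -E2; move: P1 Q1 P2 Q2; rewrite -/A -/B.
  by case: (odd N) => P1 Q1 P2 Q2; rewrite ?P1 ?Q1 ?P2 ?Q2.
rewrite -/A -/B in E1 E2.
rewrite E1 E2 [in RHS]addrAC.
move: Eu Ew; rewrite !phiD phiue phiuf phiwe phiwf => Eu Ew.
have nd' : (1 + c * d) ^+ 2 - (c + d) ^+ 2 != 0 by rewrite subr_eq0.
have ea : (a - a') * (1 + c * d) = (b - b') * (c + d).
  apply/eqP; rewrite -subr_eq0; apply/eqP; move/eqP: Eu.
  by rewrite -subr_eq0 => /eqP E; apply: oppr_inj; rewrite oppr0 -[RHS]E; ring.
have eb : (b - b') * (1 + c * d) = (a - a') * (c + d).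
  apply/eqP; rewrite -subr_eq0; apply/eqP; move/eqP: Ew.
  by rewrite -subr_eq0 => /eqP E; apply: oppr_inj; rewrite oppr0 -[RHS]E; ring.
have a0 : a - a' = 0.
  apply: (mulIf nd'); rewrite mul0r mulrBr expr2 mulrA ea -mulrA.
  rewrite [(c + d) * _]mulrC mulrA eb.
  by ring.
have b0 : b - b' = 0.
  apply: (mulIf nd'); rewrite mul0r mulrBr expr2 mulrA eb -mulrA.
  rewrite [(c + d) * _]mulrC mulrA ea.
  by ring.
by move/subr0_eq: a0 => ->; move/subr0_eq: b0 => ->.
Qed.

End LinearAlgebra.

(** * The Burau-type matrices of the generators at [q = 4] *)

Section BurauMatrices.
Set Implicit Arguments.
Unset Strict Implicit.
Import Order.TTheory GRing.Theory Num.Theory.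
Local Open Scope ring_scope.

(* Twice a primitive [2k]-th root of unity [z]: with [c = 2 z] and [d = 2 / z],
   [c d = q = 4] and [c + d] is the off-diagonal coefficient for [m s t = k]. *)
Definition braid_root (k : nat) : algC :=
  2 * sval (C_prim_root_exists (ltn0Sn k.*2.-1)).

Definition braid_coef (k : nat) : algC := braid_root k + 4 / braid_root k.

Lemma expf_neq1 (a : algC) k : (0 < k)%N -> 1 < a -> a ^+ k != 1.
Proof. by move=> k0 a1; rewrite gt_eqF // exprn_egt1 // -lt0n. Qed.

Lemma braid_rootP k (c := braid_root k) (d := 4 / c) : (2 <= k)%N ->
  [/\ c * d = 4, c != d, c ^+ k = d ^+ k, (1 + c * d) ^+ 2 != (c + d) ^+ 2 &
      (3 <= k)%N -> braid_coef k != 0].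
Proof.
move=> k2; rewrite /braid_coef /d -/c {d} /c /braid_root.
case: C_prim_root_exists => z /= pz.
(* The order was written as a successor to be positive for all [k]; here it becomes [2k]. *)
rewrite prednK in pz; last by rewrite double_gt0 (leq_trans _ k2).
have k0 : (0 < k)%N by apply: leq_trans k2.
have z0 : z != 0.
  apply/eqP => zE; have /eqP := prim_expr_order pz.
  by rewrite zE expr0n double_eq0 eqn0Ngt k0 eq_sym oner_eq0.
have n2 : 2 != 0 :> algC by rewrite pnatr_eq0.
have zk : z ^+ k * z ^+ k = 1 by rewrite -exprD addnn (prim_expr_order pz).
have z2 : z ^+ 2 != 1.
  rewrite -(prim_order_dvd pz) -[2%N]/(1.*2) -!muln2 dvdn_pmul2r //.
  by rewrite dvdn1 neq_ltn k2 orbT.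
have z2k : (z ^+ 2) ^+ k = 1 by rewrite exprAC expr2 zk.
have c0 : 2 * z != 0 by rewrite mulf_neq0.
have four : 1 < 4 :> algC by rewrite ltr1n.
split.
- by rewrite mulrC divfK.
- apply: contra z2 => /eqP E; apply/eqP.
  have : (2 * z) * (2 * z) = 4 by rewrite {2}E mulrC divfK.
  have -> : 2 * z * (2 * z) = 4 * z ^+ 2 by ring.
  by rewrite -{2}[4]mulr1 => /mulfI -> //; rewrite pnatr_eq0.
- rewrite expr_div_n; apply: (mulIf (expf_neq0 k c0)).
  rewrite divfK ?expf_neq0 // exprMn mulrACA zk mulr1 -exprMn.
  by congr (_ ^+ _); ring.
- apply/eqP => E.
  (* Equality would make [z ^+ 2] equal to [1 / 4] or [4], but it is a root of unity. *)
  have : (4 * z ^+ 2 - 1) * (z ^+ 2 - 4) = 0.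
    have -> : (4 * z ^+ 2 - 1) * (z ^+ 2 - 4) =
      z ^+ 2 * ((2 * z + 4 / (2 * z)) ^+ 2 - (1 + 2 * z * (4 / (2 * z))) ^+ 2).
      by field; rewrite z0.
    by rewrite -E subrr mulr0.
  move/eqP; rewrite mulf_eq0 !subr_eq0 => /orP[] /eqP h.
    have /eqP := expf_neq1 k0 four; apply.
    by transitivity ((4 * z ^+ 2) ^+ k); [rewrite exprMn z2k mulr1 | rewrite h expr1n].
  have /eqP := expf_neq1 k0 four; apply.
  by rewrite -h z2k.
- move=> k3; apply/eqP => E.
  (* A zero coefficient means [z ^+ 2 = -1], so that the order [2k] of [z] divides 4. *)
  have : (z ^+ 2) ^+ 2 = 1.
    have h : z ^+ 2 = -1.
      apply/eqP; rewrite -subr_eq0 opprK; apply/eqP.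
      have -> : z ^+ 2 + 1 = z / 2 * (2 * z + 4 / (2 * z)) by field; rewrite z0.
      by rewrite E mulr0.
    by rewrite h sqrrN expr1n.
  rewrite -exprM => /eqP; rewrite -(prim_order_dvd pz) => /(@dvdn_leq _ 4 isT).
  by rewrite -[4%N]/(2.*2) leq_double leqNgt k3.
Qed.

Section Matrices.
Context {S : finType} (m : S -> S -> nat).

Definition basis_row (s : S) : 'rV[algC]_#|S| := delta_mx 0 (enum_rank s).

(** The diagonal value is [- (1 + q)], so that [burau_mx s] has eigenvalue [- q] on
    [basis_row s]. *)
Definition burau_form (s t : S) : algC :=
  if s == t then -5 else braid_coef (m s t).

Definition burau_col (t : S) : 'cV[algC]_#|S| :=
  \col_i burau_form (enum_val i) t.

Definition burau_mx (s : S) : 'M[algC]_#|S| :=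
  1%:M + burau_col s *m basis_row s.

Lemma basis_row_burau_col s t :
  basis_row s *m burau_col t = (burau_form s t)%:M.
Proof.
rewrite -rowE; apply/matrixP => i j.
by rewrite !ord1 !mxE enum_rankK eqxx.
Qed.

Lemma basis_row_neq0 s : basis_row s != 0.
Proof.
by apply/eqP => /matrixP /(_ 0 (enum_rank s)) /eqP; rewrite !mxE !eqxx oner_eq0.
Qed.

Lemma mul_burau_mx v s :
  v *m burau_mx s = v + (v *m burau_col s) 0 0 *: basis_row s.
Proof. exact: mul_row_rank1. Qed.

Lemma det_burau_mx s : \det (burau_mx s) = - 4.
Proof.
rewrite det_mulmx_add1 basis_row_burau_col det_mx11 !mxE eqxx /burau_form eqxx.
by rewrite /= !mulr1n; ring.
Qed.

Lemma burau_mx_unit s : burau_mx s \in unitmx.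
Proof. by rewrite unitmxE det_burau_mx unitfE oppr_eq0 pnatr_eq0. Qed.

Lemma burau_mx_braid s t : coxeter_exponents m -> s != t ->
  \prod_(x <- alternating s t (m s t)) burau_mx x =
  \prod_(x <- alternating t s (m s t)) burau_mx x.
Proof.
case=> msym mge2 st; have [cd ncd cdN nd _] := braid_rootP (mge2 s t st).
rewrite /alternating !big_map -[m s t]subn0 -/(index_iota 0 (m s t)) !big_mkord.
have ebt : burau_form t s = burau_form s t.
  by rewrite /burau_form eq_sym (negbTE st) msym.
have five x : burau_form x x = - (1 + braid_root (m s t) * (4 / braid_root (m s t))).
  by rewrite /burau_form eqxx cd; congr (- _); ring.
have := @rank1_braid _ _ (basis_row s) (basis_row t) (burau_col s) (burau_col t)
  _ _ (m s t) ncd cdN nd.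
rewrite !basis_row_burau_col !five ebt {1 2}/burau_form (negbTE st).
move=> /(_ erefl erefl erefl erefl) /=.
under eq_bigr do rewrite -!/(burau_mx _) -(fun_if burau_mx).
move=> ->; apply: eq_bigr => i _.
by rewrite -!/(burau_mx _); case: odd.
Qed.

End Matrices.
End BurauMatrices.

(** * The representation of the Artin group and the modulus of its determinant *)

Section BurauRepresentation.
Set Implicit Arguments.
Unset Strict Implicit.
Import Order.TTheory GRing.Theory Num.Theory.
Local Open Scope ring_scope.
Context {S : finType} (m : S -> S -> nat).

Definition word_mx (w : word S) : 'M[algC]_#|S| :=
  \prod_(x <- w) (if x.2 then invmx (burau_mx m x.1) else burau_mx m x.1).

Lemma word_mx_cat u v : word_mx (u ++ v) = word_mx u *m word_mx v.
Proof. exact: big_cat. Qed.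

Lemma word_mx_eq u v : coxeter_exponents m ->
  word_eq (artin_relation m) u v -> word_mx u = word_mx v.
Proof.
move=> hm; elim=> {u v} //.
- by move=> u v w _ -> _ ->.
- by move=> u u' v v' _ Eu _ Ev; rewrite !word_mx_cat Eu Ev.
- move=> s b; rewrite /word_mx !big_cons big_nil mulr1 /=.
  by case: b => /=; [apply: mulVmx | apply: mulmxV]; apply: burau_mx_unit.
- move=> u v [s [t [st -> ->]]]; rewrite /word_mx /pos_word !big_map /=.
  by move: (burau_mx_braid hm st); rewrite /alternating !big_map.
Qed.

Definition burau_rep (G : groupType) (sigma : S -> G)
    (rho : G -> 'M[algC]_#|S|) : Prop :=
  [/\ rho 1%g = 1%:M, forall g h, rho (g * h)%g = rho g *m rho h &
      forall s, rho (sigma s) = burau_mx m s].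

(** Each element is sent to the matrix of a chosen word; the matrices respect the relations, so the
    choice is irrelevant. *)
Lemma burau_rep_exists (G : groupType) (sigma : S -> G) :
  coxeter_exponents m -> presents (artin_relation m) sigma ->
  exists rho, burau_rep sigma rho.
Proof.
move=> hm [gen rel].
have [w wE] := choice gen.
have E u g : g = eval_word sigma u -> word_mx (w g) = word_mx u.
  by move=> gE; apply/(word_mx_eq hm)/rel; rewrite -gE -wE.
exists (word_mx \o w); split=> [|g h|s] /=.
- rewrite (E [::]); first by rewrite /word_mx big_nil.
  by rewrite /eval_word big_nil.
- by rewrite -word_mx_cat; apply: E; rewrite /eval_word big_cat -!/(eval_word _ _) -!wE.
- rewrite (E [:: (s, false)]); first by rewrite /word_mx big_seq1.
  by rewrite /eval_word big_seq1.
Qed.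

Context {G : groupType} {sigma : S -> G} (rho : G -> 'M[algC]_#|S|).
Hypothesis hrho : burau_rep sigma rho.

Let rho1 : rho 1%g = 1%:M. Proof. by case: hrho. Qed.
Let rhoM g h : rho (g * h)%g = rho g *m rho h. Proof. by case: hrho. Qed.
Let rho_sigma s : rho (sigma s) = burau_mx m s. Proof. by case: hrho. Qed.

Lemma rhoVK g : rho g^-1%g *m rho g = 1%:M.
Proof. by rewrite -rhoM mulVg. Qed.

Lemma rhoKV g : rho g *m rho g^-1%g = 1%:M.
Proof. by rewrite -rhoM mulgV. Qed.

(** The modulus removes the sign of the determinant [- 4] of a generator: a product of [l]
    generators has height [4 ^+ l]. *)
Definition height (g : G) : algC := `|\det (rho g)|.

Lemma height1 : height 1%g = 1.
Proof. by rewrite /height rho1 det1 normr1. Qed.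

Lemma heightM g h : height (g * h)%g = height g * height h.
Proof. by rewrite /height rhoM det_mulmx normrM. Qed.

Lemma heightV g : height g^-1%g * height g = 1.
Proof. by rewrite -heightM mulVg height1. Qed.

Lemma heightJ g h : height (g ^ h)%g = height g.
Proof. by rewrite !heightM mulrCA heightV mulr1. Qed.

Lemma heightX g n : height (g ^+ n)%g = height g ^+ n.
Proof. by elim: n => [|n IH]; rewrite ?expg0 ?height1 // expgS heightM IH exprS. Qed.

Lemma height_prod (l : seq S) : height (\prod_(s <- l) sigma s)%g = 4 ^+ size l.
Proof.
elim: l => [|s l IH]; first by rewrite big_nil height1.
rewrite big_cons heightM IH /= exprS; congr (_ * _).
by rewrite /height rho_sigma det_burau_mx normrN normr_nat.
Qed.

Lemma positive_height g h : positive sigma (g ^ h) -> 1 < height g \/ g = 1%g.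
Proof.
case=> -[|s l] E; last first.
  by left; rewrite -(heightJ g h) E height_prod exprn_egt1 // ltr1n.
by right; apply/eqP; rewrite -(conjg_eq1 _ h) E big_nil.
Qed.

Lemma height_neg g n : 1 < height g -> height (g ^- n)%g <= 1.
Proof.
move=> g1; have := heightV (g ^+ n)%g; rewrite heightX.
have k1 : 1 <= height g ^+ n by rewrite exprn_ege1 // ltW.
have k0 : 0 < height g ^+ n by apply: lt_le_trans k1.
move=> E; rewrite -(ler_pM2r k0) E mul1r //.
Qed.

End BurauRepresentation.

(** * Conjugates, generated subgroups and centers *)

Section Groups.
Set Implicit Arguments.
Unset Strict Implicit.
Context {G : groupType}.
Implicit Types (P A : set G) (g h x y z : G).

Lemma conj_setE P h g : conj_set P h g <-> P (g ^ h^-1).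
Proof.
split=> [[x Px <-]|Pg]; first by rewrite conjgK.
by exists (g ^ h^-1) => //; rewrite conjgKV.
Qed.

Lemma conj_set1 P : conj_set P 1 = P.
Proof. by apply/seteqP; split=> g; rewrite conj_setE invg1 conjg1. Qed.

Lemma conj_setM P g h : conj_set P (g * h) = conj_set (conj_set P g) h.
Proof.
by apply/seteqP; split=> x; rewrite !conj_setE invgM conjgM.
Qed.

Lemma conj_setK P h : conj_set (conj_set P h) h^-1 = P.
Proof. by rewrite -conj_setM mulgV conj_set1. Qed.

Lemma conj_setVK P h : conj_set (conj_set P h^-1) h = P.
Proof. by rewrite -conj_setM mulVg conj_set1. Qed.

Lemma conj_set_inj h : injective (fun P => conj_set P h).
Proof. by move=> P Q E; rewrite -(conj_setK P h) E conj_setK. Qed.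

Lemma conj_set_sub P Q h : P `<=` Q -> conj_set P h `<=` conj_set Q h.
Proof. by move=> PQ g; rewrite !conj_setE => /PQ. Qed.

Lemma conj_set_trivial h : conj_set [set 1] h = [set 1 : G].
Proof.
apply/seteqP; split=> g; rewrite conj_setE /=.
  by move/eqP; rewrite conjg_eq1 => /eqP.
by move=> ->; rewrite conj1g.
Qed.

Lemma conj_setT h : conj_set setT h = [set: G].
Proof. by apply/seteqP; split=> g //; rewrite conj_setE. Qed.

Lemma conj_set_X P g n : conj_set P g = P -> conj_set P (g ^+ n) = P.
Proof.
by move=> E; elim: n => [|n IH]; rewrite ?expg0 ?conj_set1 // expgS conj_setM E.
Qed.

(** The conjugates of [P] by successive powers of [g] form a decreasing chain that returns to [P],
    so it is constant. *)
Lemma conj_set_sub_X P g n : (0 < n)%N ->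
  conj_set P g `<=` P -> conj_set P (g ^+ n) = P -> conj_set P g = P.
Proof.
case: n => // n _ gP E; apply/seteqP; split=> //.
rewrite -{1}E expgSr conj_setM; apply: conj_set_sub.
elim: n {E} => [|n IH]; first by rewrite expg0 conj_set1.
by rewrite expgSr conj_setM; apply: subset_trans gP; apply: conj_set_sub.
Qed.

Lemma commuteJ x y h : commute (x ^ h) (y ^ h) <-> commute x y.
Proof.
rewrite /commute -!conjMg; split=> [|->] //.
exact: conjg_inj.
Qed.

Lemma subgroup_generated_by A : is_subgroup (generated_by A).
Proof.
split=> [B [[]]|x y Ax Ay B BA] //.
by case: (BA) => -[_ BD] _; apply: BD; [apply: Ax | apply: Ay].
Qed.

Lemma conj_generated_by A h :
  conj_set (generated_by A) h = generated_by (conj_set A h).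
Proof.
have sub (B : set G) (k : G) : conj_set (generated_by B) k `<=` generated_by (conj_set B k).
  move=> g /conj_setE; rewrite -{2}(conjgKV k g); move: (g ^ k^-1) => {}g.
  move: g; apply: smallest_sub.
    split=> [|x y]; first by rewrite conj1g; case: (subgroup_generated_by (conj_set B k)).
    rewrite conjMg conjVg; case: (subgroup_generated_by (conj_set B k)) => _; exact.
  by move=> g Bg; apply: sub_gen_smallest; exists g.
apply/seteqP; split; first exact: sub.
rewrite -[X in X `<=` _](conj_setVK _ h); apply: conj_set_sub.
by apply: subset_trans (sub _ _) _; rewrite conj_setK.
Qed.

Lemma generated_by_set1 z g : generated_by [set z] g ->
  exists n, g = z ^+ n \/ g = z ^- n.
Proof.
move: g; apply: smallest_sub => [|_ ->]; last by exists 1%N; left.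
split=> [|x y [k hk] [n hn]]; first by exists 0%N; left.
have pm i j : exists l, z ^+ i / z ^+ j = z ^+ l \/ z ^+ i / z ^+ j = z ^- l.
  case: (leqP j i) => ij; first by exists (i - j)%N; left; rewrite expgnFr.
  exists (j - i)%N; right; rewrite expgnFr 1?ltnW //.
  by rewrite invgF.
case: hk hn => -> [] ->; rewrite ?invgK.
- exact: pm.
- by exists (k + n)%N; left; rewrite expgnDr.
- by exists (n + k)%N; right; rewrite expgnDr invgM.
- have [l hl] := pm n k; exists l.
  have -> : z ^- k * z ^+ n = z ^+ n / z ^+ k; last by [].
  by apply/commute_sym/commuteV/commuteX2.
Qed.

Lemma conj_subgroup_center P h :
  subgroup_center (conj_set P h) = conj_set (subgroup_center P) h.
Proof.
apply/seteqP; split=> z; rewrite conj_setE => -[].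
  move=> /conj_setE Pz zP; split=> // g Pg.
  by apply/(commuteJ _ _ h); rewrite conjgKV; apply: zP; apply/conj_setE; rewrite conjgK.
move=> Pz zP; split; first exact/conj_setE.
by move=> g /conj_setE Pg; apply/(commuteJ _ _ h^-1); apply: zP.
Qed.

End Groups.

(** * Uniqueness and equivariance of the central generators *)

Section Zeta.
Set Implicit Arguments.
Unset Strict Implicit.
Import Order.TTheory GRing.Theory Num.Theory.
Context {S : finType} (m : S -> S -> nat) {G : groupType} {sigma : S -> G}.
Context {rho : G -> 'M[algC]_#|S|}.
Hypothesis hrho : burau_rep m sigma rho.

(** Each of [x] and [y] is a power of the other. Unless one is trivial, both have height above 1;
    this excludes negative exponents and forces the product of the two exponents to be 1. *)
Lemma positive_generator_unique x y :
  (exists h, positive sigma (x ^ h)) -> (exists h, positive sigma (y ^ h)) ->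
  generated_by [set x] = generated_by [set y] -> x = y.
Proof.
move=> [h hx] [k ky] E.
have mem (z : G) : generated_by [set z] z by apply: sub_gen_smallest.
have [i iE] : exists i, y = x ^+ i \/ y = x ^- i.
  by apply: generated_by_set1; rewrite E; apply: mem.
have [j jE] : exists j, x = y ^+ j \/ x = y ^- j.
  by apply: generated_by_set1; rewrite -E; apply: mem.
have [x1|x1] := positive_height hrho hx; last first.
  by case: iE => ->; rewrite x1 expg1n ?invg1.
have [y1|y1] := positive_height hrho ky; last first.
  by case: jE => ->; rewrite y1 expg1n ?invg1.
case: iE => [iE|iE]; last first.
  by have := height_neg hrho i x1; rewrite -iE => /(lt_le_trans y1); rewrite ltxx.
case: jE => [jE|jE]; last first.
  by have := height_neg hrho j y1; rewrite -jE => /(lt_le_trans x1); rewrite ltxx.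
have : (height rho x ^+ (i * j) = height rho x)%R.
  by rewrite -(heightX hrho) expgnA -iE -jE.
have inj : injective (GRing.exp (height rho x)).
  by apply: ieexprIn; [apply: lt_trans x1 | rewrite gt_eqF].
rewrite -[RHS]expr1 => /inj /eqP; rewrite muln_eq1.
by case/andP => /eqP i1 _; rewrite iE i1 expg1.
Qed.

Lemma zeta_conj P h : zeta sigma (conj_set P h) = zeta sigma P ^ h.
Proof.
pose Z P := [set z | subgroup_center P = generated_by [set z] /\
                     exists h, positive sigma (z ^ h)].
have ZJ Q z k : Z Q z -> Z (conj_set Q k) (z ^ k).
  case=> zE [l zl]; split; last by exists (k^-1 * l); rewrite -conjgM mulKVg.
  rewrite conj_subgroup_center zE conj_generated_by; congr generated_by.
  by rewrite /conj_set image_set1.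
have uniqZ Q y z : Z Q y -> Z Q z -> y = z.
  move=> [Ey py] [Ez pz]; apply: positive_generator_unique => //.
  by rewrite -Ey -Ez.
have [[z Zz]|nZ] := pselect (exists z, Z P z).
  have -> : zeta sigma P = z.
    exact: (@xget_unique _ 1 (Z P) z Zz (fun y Zy => uniqZ _ _ _ Zy Zz)).
  have Zzh := ZJ _ _ h Zz.
  exact: (@xget_unique _ 1 (Z _) (z ^ h) Zzh (fun y Zy => uniqZ _ _ _ Zy Zzh)).
(* Without a candidate for [P] there is none for its conjugate, and both sides are the default value
   1. *)
rewrite /zeta !xgetPN ?conj1g // => z Zz; apply: nZ; first by exists z.
by exists (z ^ h^-1); rewrite -[P](conj_setK _ h); apply: ZJ.
Qed.

Lemma adjacentJ P Q h :
  adjacent sigma (conj_set P h) (conj_set Q h) <-> adjacent sigma P Q.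
Proof. by rewrite /adjacent !zeta_conj; apply: commuteJ. Qed.

(** Turns stability of a subgroup into commutation: it serves for [Q] fixed by a power of [gamma],
    and for [P] fixed by [zeta sigma Q]. *)
Lemma zeta_fixed P h : conj_set P h = P -> commute (zeta sigma P) h.
Proof. by move=> E; rewrite /commute conjgC -zeta_conj E. Qed.

End Zeta.

(** * Coordinate subspaces *)

Section CoordinateSubspaces.
Set Implicit Arguments.
Unset Strict Implicit.
Import Order.TTheory GRing.Theory Num.Theory.
Local Open Scope ring_scope.
Context {S : finType}.
Implicit Types (X Y : {set S}) (v w : 'rV[algC]_#|S|) (M : 'M[algC]_#|S|).

(** This subspace is the span of the root vectors of the generators in [X]. *)
Definition supported X v : Prop :=
  forall s, s \notin X -> v 0 (enum_rank s) = 0.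

Lemma supported0 X : supported X 0.
Proof. by move=> s _; rewrite mxE. Qed.

Lemma supportedD X v w : supported X v -> supported X w -> supported X (v + w).
Proof. by move=> Xv Xw s sX; rewrite mxE Xv ?Xw // addr0. Qed.

Lemma supportedZ X a v : supported X v -> supported X (a *: v).
Proof. by move=> Xv s sX; rewrite mxE Xv ?mulr0. Qed.

Lemma supported_basis_row X s : supported X (basis_row s) <-> s \in X.
Proof.
split=> [H|sX t tX].
  have [//|/H /eqP] := boolP (s \in X).
  by rewrite mxE !eqxx oner_eq0.
rewrite mxE eqxx (inj_eq enum_rank_inj).
by have [E|] := eqVneq t s => //=; rewrite E sX in tX.
Qed.

Lemma row_sum_basis_row v :
  v = \sum_(s : S) v 0 (enum_rank s) *: basis_row s.
Proof.
rewrite {1}[v]row_sum_delta (reindex (@enum_rank S)) //.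
by exists enum_val => i _; rewrite ?enum_valK ?enum_rankK.
Qed.

Lemma supported_mulmx X Y v M :
  (forall s, s \in X -> supported Y (basis_row s *m M)) ->
  supported X v -> supported Y (v *m M).
Proof.
move=> XM Xv; rewrite [v]row_sum_basis_row mulmx_suml.
apply: (big_ind (supported Y)) => [||s _].
- exact: supported0.
- exact: supportedD.
- have [sX|sX] := boolP (s \in X).
    by rewrite -scalemxAl; apply/supportedZ/XM.
  by rewrite Xv // scale0r mul0mx; apply: supported0.
Qed.

Lemma supported_mulmx_scalar X v M a :
  (forall s, s \in X -> basis_row s *m M = a *: basis_row s) ->
  supported X v -> v *m M = a *: v.
Proof.
move=> XM Xv; rewrite [v]row_sum_basis_row mulmx_suml scaler_sumr.
apply: eq_bigr => s _; have [sX|sX] := boolP (s \in X).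
  by rewrite -scalemxAl XM // !scalerA mulrC.
by rewrite Xv // !scale0r mul0mx scaler0.
Qed.

End CoordinateSubspaces.

(** * The action of parabolic subgroups on spans of root vectors *)

Section ParabolicAction.
Set Implicit Arguments.
Unset Strict Implicit.
Import Order.TTheory GRing.Theory Num.Theory.
Local Open Scope ring_scope.
Context {S : finType} (m : S -> S -> nat) {G : groupType} {sigma : S -> G}.
Context {rho : G -> 'M[algC]_#|S|}.
Hypothesis hm : coxeter_exponents m.
Hypothesis hrho : burau_rep m sigma rho.

Let rhoM g h : rho (g * h)%g = rho g *m rho h. Proof. by case: hrho. Qed.
Let rho_sigma s : rho (sigma s) = burau_mx m s. Proof. by case: hrho. Qed.

(** A generator moves every vector by a multiple of its own root vector. *)
Lemma parabolic_supported (X : {set S}) g :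
  parabolic_of sigma X g -> forall v, supported X (v *m rho g - v).
Proof.
move: g; apply: smallest_sub; last first.
  move=> _ [s /= sX <-] v; rewrite rho_sigma mul_burau_mx addrC addKr.
  exact/supportedZ/supported_basis_row.
split=> [v|g h Xg Xh v].
  by case: hrho => -> _ _; rewrite mulmx1 subrr; apply: supported0.
rewrite rhoM mulmxA; set w := _ *m rho h^-1%g.
have wh : w *m rho h = v *m rho g by rewrite -mulmxA (rhoVK hrho) mulmx1.
have -> : w - v = (v *m rho g - v) + (-1) *: (w *m rho h - w).
  by rewrite wh scaleN1r opprB [RHS]addrC subrKA.
by apply: supportedD; [apply: Xg | apply/supportedZ/Xh].
Qed.

Lemma sigma_in_parabolic (X : {set S}) s :
  s \in X -> parabolic_of sigma X (sigma s).
Proof. by move=> sX; apply: sub_gen_smallest; exists s. Qed.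

Lemma mulmx_burau_mxB (v : 'rV[algC]_#|S|) s :
  v *m burau_mx m s - v = (v *m burau_col m s) 0 0 *: basis_row s.
Proof. by rewrite mul_burau_mx addrC addKr. Qed.

(* The root vector of the reflection [sigma s ^ h] is [basis_row s *m rho h]. *)
Lemma conj_in_parabolic_supported (X : {set S}) s h :
  parabolic_of sigma X (sigma s ^ h)%g -> supported X (basis_row s *m rho h).
Proof.
move=> /parabolic_supported /(_ (basis_row s *m rho h)).
rewrite conjgE !rhoM rho_sigma !mulmxA -[_ *m rho h *m _]mulmxA (rhoKV hrho) mulmx1.
(* The conjugate of [sigma s] displaces its own root vector by [-5] times that vector, and [-5] is
   invertible. *)
rewrite -mulmxBl mulmx_burau_mxB basis_row_burau_col.
rewrite -scalemxAl /burau_form eqxx !mxE eqxx mulr1n => /(supportedZ (-5)^-1).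
by rewrite scalerA mulVf ?scale1r // oppr_eq0 pnatr_eq0.
Qed.

Lemma burau_form_neq0 s t : dynkin_edge m s t -> burau_form m s t != 0.
Proof.
case/andP=> st m3; rewrite /burau_form (negbTE st).
by have [_ _ _ _] := braid_rootP (hm.2 s t st); apply.
Qed.

(** The image of [rho (sigma s) - 1] is the line of [basis_row s], which [rho c] therefore
    preserves. Along an edge the form is nonzero, which makes the two eigenvalues equal;
    connectedness does the rest. *)
Lemma commuting_scalar (X : {set S}) c : dynkin_connected m X ->
  (forall s, s \in X -> commute c (sigma s)) ->
  exists a, forall s, s \in X -> basis_row s *m rho c = a *: basis_row s.
Proof.
move=> Xconn Xc.
have cs s : s \in X -> rho c *m burau_mx m s = burau_mx m s *m rho c.
  by move=> sX; rewrite -rho_sigma -!rhoM Xc.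
have eig s : s \in X -> {a | basis_row s *m rho c = a *: basis_row s}.
  move=> sX; exists ((-5)^-1 * (basis_row s *m rho c *m burau_col m s) 0 0).
  have : basis_row s *m rho c *m burau_mx m s - basis_row s *m rho c =
         - 5 *: (basis_row s *m rho c).
    rewrite -mulmxA cs // mulmxA -mulmxBl mulmx_burau_mxB -scalemxAl.
    by rewrite basis_row_burau_col /burau_form eqxx mxE eqxx mulr1n.
  rewrite mulmx_burau_mxB -scalerA => ->.
  by rewrite scalerA mulVf ?scale1r // oppr_eq0 pnatr_eq0.
have [-> |[s0 s0X]] := set_0Vmem X; first by exists 1 => s; rewrite inE.
have [a s0a] := eig s0 s0X; exists a => s sX.
have /connectP[p] := Xconn s0 s s0X sX.
elim: p s0 s0X s0a => [|t p IH] s0 s0X s0a /=; first by move=> _ ->.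
case/andP=> /and3P[_ tX edge] pathp sE; apply: IH pathp sE => //.
have [b tb] := eig t tX; rewrite tb; congr (_ *: _).
have := congr1 (mulmx (basis_row s0)) (cs t tX).
rewrite !mulmxA s0a -scalemxAl !mul_burau_mx basis_row_burau_col scalerDr mulmxDl s0a.
rewrite -scalemxAl tb => /addrI /eqP.
rewrite !scalerA -subr_eq0 -scalerBl scaler_eq0 (negbTE (basis_row_neq0 _)) orbF.
rewrite mxE eqxx mulr1n mulrC -mulrBr mulf_eq0 (negbTE (burau_form_neq0 edge)) /=.
by rewrite subr_eq0 => /eqP.
Qed.

(** The image of [rho c - 1] lies in the span of the root vectors of [X], where [rho c] is a scalar
    [a]. If [a ^+ n = 1], then [rho (c ^+ n) - 1] has square zero, so [c ^+ n] has height 1, against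
    [1 < height rho c]. *)
Lemma commuting_element_quadratic (X : {set S}) c h : dynkin_connected m X ->
  parabolic_of sigma X c -> (forall s, s \in X -> commute c (sigma s)) ->
  1 < height rho c ->
  exists a, (rho (c ^ h)%g - 1%:M) *m (rho (c ^ h)%g - a%:M) = 0 /\
            forall n, (0 < n)%N -> a ^+ n != 1.
Proof.
move=> Xconn Pc Xc c1; have [a Ea] := commuting_scalar Xconn Xc.
exists a; split.
  have E b : rho (c ^ h)%g - b%:M = rho h^-1%g *m (rho c - b%:M) *m rho h.
    rewrite mulmxBr mulmxBl !rhoM !mulmxA; congr (_ - _).
    by rewrite mul_mx_scalar -scalemxAl (rhoVK hrho) scalemx1.
  rewrite !E !mulmxA -[_ *m rho h *m rho _]mulmxA (rhoKV hrho) mulmx1.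
  rewrite -[_ *m (rho c - 1%:M) *m _]mulmxA.
  suff -> : (rho c - 1%:M) *m (rho c - a%:M) = 0 by rewrite mulmx0 mul0mx.
  apply/row_matrixP => i; rewrite row_mul row0 mulmxBr mul_mx_scalar.
  apply/eqP; rewrite subr_eq0; apply/eqP; apply: supported_mulmx_scalar Ea _.
  by rewrite linearB /= rowE [row i 1%:M]rowE mulmx1; apply: parabolic_supported.
move=> n n0; apply/eqP => an.
have cn1 : 1 < height rho (c ^+ n)%g by rewrite (heightX hrho) exprn_egt1 // -lt0n.
have Pcn : parabolic_of sigma X (c ^+ n)%g.
  have [H1 HM] := subgroup_generated_by [set sigma s | s in [set` X]].
  elim: n {n0 an cn1} => [|n IH]; first exact: H1.
  have := HM _ _ IH (HM _ _ H1 Pc).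
  by rewrite invgM invgK invg1 mulg1 -expgSr.
have fixed v : supported X v -> v *m rho (c ^+ n)%g = v.
  move=> Xv; rewrite -[RHS]scale1r -an.
  elim: n {n0 an cn1 Pcn} => [|n IH].
    by case: hrho => -> _ _; rewrite mulmx1 scale1r.
  by rewrite expgSr rhoM mulmxA IH -scalemxAl (supported_mulmx_scalar Ea Xv) scalerA exprSr.
move: cn1; rewrite /height -[rho _](subrK 1%:M) addrC det_unipotent.
  by rewrite normr1 ltxx.
apply/row_matrixP => i; rewrite row_mul row0 mulmxBr mulmx1.
apply/eqP; rewrite subr_eq0; apply/eqP; apply: fixed.
by rewrite linearB /= rowE [row i 1%:M]rowE mulmx1; apply: parabolic_supported.
Qed.

(** This is the remainder of the [n]-th power of [X] modulo [(X - 1) (X - a)], multiplied by [a - 1]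
    to avoid a division. *)
Lemma quadratic_power (a : algC) g n :
  (rho g - 1%:M) *m (rho g - a%:M) = 0 ->
  (a - 1) *: rho (g ^+ n)%g = (a ^+ n - 1) *: rho g + (a - a ^+ n)%:M.
Proof.
move=> E.
have sq : rho g *m rho g = (1 + a) *: rho g - a%:M.
  apply/eqP; rewrite -subr_eq0 -E; apply/eqP.
  rewrite mulmxBl !mulmxBr !mul1mx mul_mx_scalar scalerDl scale1r !opprD !opprK.
  by rewrite !addrA; congr (_ + _); rewrite addrAC.
elim: n => [|n IH].
  by case: hrho => -> _ _; rewrite subrr scale0r add0r scale_scalar_mx mulr1.
rewrite expgSr rhoM scalemxAl IH mulmxDl -scalemxAl sq mul_scalar_mx.
rewrite -[a%:M]scalemx1 -[X in _ = _ + X]scalemx1 scalerBr !scalerA addrAC -scalerDl.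
by rewrite -scaleNr exprS; congr (_ *: _ + _ *: _); ring.
Qed.

(** As [a ^+ n != 1], [rho g] is a combination of 1 and [rho (g ^+ n)], so it preserves the span for
    [X]. For [t] in [Y], the root vector of [sigma t ^ g^-1] lies in that span, and [rho g] maps it
    to [basis_row t]. *)
Lemma parabolic_power_stable (X Y : {set S}) g a n :
  (rho g - 1%:M) *m (rho g - a%:M) = 0 -> a ^+ n != 1 ->
  conj_set (parabolic_of sigma X) (g ^+ n)%g = parabolic_of sigma X ->
  conj_set (parabolic_of sigma X) g = parabolic_of sigma Y ->
  Y \subset X.
Proof.
move=> Eg an gnX gY.
have Vgn s : s \in X -> supported X (basis_row s *m rho (g ^+ n)%g).
  move=> sX; apply: conj_in_parabolic_supported.
  by rewrite -gnX; exists (sigma s) => //; apply: sigma_in_parabolic.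
have Vg v : supported X v -> supported X (v *m rho g).
  apply: supported_mulmx => s sX.
  have := quadratic_power n Eg => /(congr1 (mulmx (basis_row s))).
  rewrite mulmxDr -!scalemxAr mul_mx_scalar => /eqP.
  rewrite -subr_eq eq_sym => /eqP E.
  have an0 : a ^+ n - 1 != 0 by rewrite subr_eq0.
  have -> : basis_row s *m rho g = (a ^+ n - 1)^-1 *: ((a ^+ n - 1) *: (basis_row s *m rho g)).
    by rewrite scalerA mulVf // scale1r.
  rewrite E -scaleNr; apply/supportedZ/supportedD; apply/supportedZ; first exact: Vgn.
  exact/supported_basis_row.
apply/fintype.subsetP => t tY; apply/(supported_basis_row X).
have /conj_setE Xt : conj_set (parabolic_of sigma X) g (sigma t).
  by rewrite gY; apply: sigma_in_parabolic.
have := Vg _ (conj_in_parabolic_supported Xt).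
by rewrite -mulmxA (rhoVK hrho) mulmx1.
Qed.

End ParabolicAction.

(** * Finite orbits and periodicity *)

Section PeriodicSubgroups.
Set Implicit Arguments.
Unset Strict Implicit.
Context {G : groupType}.
Implicit Types (P Q : set G) (g h z : G).

Definition periodic g P : Prop :=
  exists2 k, (0 < k)%N & conj_set P (g ^+ k) = P.

(** Pigeonhole: without a period, the conjugates by the powers of [g] would be pairwise distinct. *)
Lemma finite_family_periodic g P (M : set (set G)) :
  finite_set M -> (forall n, M (conj_set P (g ^+ n))) -> periodic g P.
Proof.
move=> finM MP; apply: contrapT => nper; apply: infinite_nat.
have lt_neq i j : (i < j)%N -> conj_set P (g ^+ i) <> conj_set P (g ^+ j).
  move=> ij E; apply: nper; exists (j - i)%N; first by rewrite subn_gt0.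
  by rewrite expgnFr 1?ltnW // conj_setM -E conj_setK.
have inj : injective (fun n => conj_set P (g ^+ n)).
  by move=> i j E; case: (ltngtP i j) => // /lt_neq; rewrite E.
apply: sub_finite_set (finite_preimage (in2W inj) finM).
by move=> n _; apply: MP.
Qed.

Lemma periodic_mul g P k n :
  conj_set P (g ^+ k) = P -> conj_set P (g ^+ (k * n)) = P.
Proof. by rewrite expgnA; apply: conj_set_X. Qed.

Lemma finite_orbitP g P : finite_set (orbit_under g P) <-> periodic g P.
Proof.
split=> [fin|[k k0 kP]].
  by apply: finite_family_periodic fin _ => n; exists n; left.
apply: sub_finite_set (finite_image (fun i => conj_set P (g ^+ i)) (finite_II k)).
have mod n : conj_set P (g ^+ n) = conj_set P (g ^+ (n %% k)).
  by rewrite {1}(divn_eq n k) expgnDr conj_setM mulnC periodic_mul.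
move=> Q [n [|] ->]; first by exists (n %% k)%N; rewrite /= ?ltn_mod -?mod.
(* Since [g ^+ (k * n)] fixes [P], the negative power [g ^- n] acts on it as [g ^+ (k * n - n)]. *)
exists ((k * n - n) %% k)%N; rewrite /= ?ltn_mod // -mod.
by rewrite expgnFr ?leq_pmull // conj_setM periodic_mul.
Qed.

(** [h] commutes with [g ^+ (k * n)], which fixes [P] when [k] is a period. *)
Lemma periodic_conj g h P n : (0 < n)%N -> commute h (g ^+ n) ->
  periodic g P -> periodic g (conj_set P h).
Proof.
move=> n0 hg [k k0 kP]; exists (k * n)%N; first by rewrite muln_gt0 k0.
have hk : commute h (g ^+ (k * n)) by rewrite mulnC expgnA; apply: commuteX.
by rewrite -conj_setM hk conj_setM periodic_mul.
Qed.

End PeriodicSubgroups.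

(** * The canonical reduction system and standard orbits *)

Section CanonicalReductionSystem.
Set Implicit Arguments.
Unset Strict Implicit.
Import Order.TTheory GRing.Theory Num.Theory.
Context {S : finType} (m : S -> S -> nat) {G : groupType} {sigma : S -> G}.
Context {rho : G -> 'M[algC]_#|S|}.
Hypothesis hm : coxeter_exponents m.
Hypothesis hrho : burau_rep m sigma rho.

Lemma proper_irreducible_parabolicJ P h :
  proper_irreducible_parabolic m sigma P ->
  proper_irreducible_parabolic m sigma (conj_set P h).
Proof.
case=> -[X [k [Xconn ->]]] n1 nT; split.
- by exists X, (k * h); rewrite conj_setM.
- by rewrite -(conj_set_trivial h) => /conj_set_inj.
- by rewrite -(conj_setT h) => /conj_set_inj.
Qed.

Lemma reduction_subgroup_periodic g P : reduction_subgroup m sigma g P ->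
  proper_irreducible_parabolic m sigma P /\ periodic g P.
Proof.
case=> M [[[finM Mp _] MgM] MP]; split; first exact: Mp.
apply: finite_family_periodic finM _ => n.
elim: n => [|n IH]; first by rewrite expg0 conj_set1.
by rewrite expgSr conj_setM -MgM; exists (conj_set P (g ^+ n)).
Qed.

Lemma CRS_periodicP g P : CRS m sigma g P <->
  [/\ proper_irreducible_parabolic m sigma P, periodic g P &
      essential m sigma g P].
Proof.
split=> [[/reduction_subgroup_periodic[pP gP] eP] //|[pP gP eP]].
split=> //; exists (orbit_under g P); split; last first.
  by exists 0%N; left; rewrite expg0 conj_set1.
have orbE Q : orbit_under g P Q <-> exists n, Q = conj_set P (g ^+ n).
  split=> [[n [->|->]]|[n ->]]; [by exists n| |by exists n; left].
  case: gP => k k0 kP; exists (k * n - n)%N.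
  by rewrite expgnFr ?leq_pmull // conj_setM periodic_mul.
have adj i j : (i <= j)%N ->
    adjacent sigma (conj_set P (g ^+ i)) (conj_set P (g ^+ j)).
  move=> ij; rewrite -(subnK ij) expgnDr conj_setM; apply/(adjacentJ hrho).
  apply: eP; first exact: proper_irreducible_parabolicJ.
  apply/finite_orbitP; apply: (@periodic_conj _ g _ _ 1) gP => //.
  by rewrite expg1; apply/commute_sym/commuteX.
split; first split.
- exact/finite_orbitP.
- by move=> _ /orbE[n ->]; apply: proper_irreducible_parabolicJ.
- move=> _ _ /orbE[i ->] /orbE[j ->];
  by case: (leqP i j) => [|/ltnW] /adj.
apply/seteqP; split=> Q.
  by case=> _ /orbE[n ->] <-; apply/orbE; exists n.+1; rewrite expgSr conj_setM.
move=> /orbE[n ->]; case: gP => -[//|k] _ kP.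
(* The period is [k.+1] here, so one more conjugation by [g] gives the exponent [n] back. *)
exists (conj_set P (g ^+ (k + n))); first by apply/orbE; exists (k + n)%N.
by rewrite -conj_setM -expgSr -addSn expgnDr conj_setM kP.
Qed.

(** Conjugation by [z] or its inverse preserves periodicity, so testing [conj_set P z] against [Q]
    amounts to testing [P] against [conj_set Q z^-1]. *)
Lemma CRS_conj g z n P : (0 < n)%N -> commute z (g ^+ n) ->
  CRS m sigma g P -> CRS m sigma g (conj_set P z).
Proof.
move=> n0 zg /CRS_periodicP[pP gP eP]; apply/CRS_periodicP; split.
- exact: proper_irreducible_parabolicJ.
- exact: periodic_conj n0 zg gP.
move=> Q pQ /finite_orbitP gQ; rewrite -(conj_setVK Q z).
apply/(adjacentJ hrho)/eP; first exact: proper_irreducible_parabolicJ.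
apply/finite_orbitP; apply: periodic_conj n0 _ gQ.
exact/commute_sym/commuteV/commute_sym.
Qed.

Lemma finite_standard_parabolics : finite_set (standard_parabolic sigma).
Proof.
apply: sub_finite_set (finite_image (parabolic_of sigma) (@finite_finset _ setT)).
by move=> _ [X ->]; exists X.
Qed.

(** The spans of root vectors give that the conjugate by [g] is contained in the subgroup;
    periodicity then upgrades the inclusion to an equality. *)
Lemma standard_orbit_fixed (X : {set S}) (a : algC) g :
  ((rho g - 1%:M) *m (rho g - a%:M) = 0)%R ->
  (forall n, (0 < n)%N -> (a ^+ n != 1)%R) ->
  (forall n, standard_parabolic sigma (conj_set (parabolic_of sigma X) (g ^+ n))) ->
  conj_set (parabolic_of sigma X) g = parabolic_of sigma X.
Proof.
move=> quad an stdX.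
have [n n0 nX] := finite_family_periodic finite_standard_parabolics stdX.
apply: (conj_set_sub_X n0 _ nX).
have [Y YE] := stdX 1%N; rewrite expg1 in YE; rewrite YE.
have /fintype.subsetP YX := parabolic_power_stable hrho quad (an n n0) nX YE.
apply: smallest_sub; first exact: subgroup_generated_by.
by move=> _ [s /= sY <-]; apply: sigma_in_parabolic; apply: YX.
Qed.

Lemma standard_orbit_adjacent P Q :
  standard_parabolic sigma P -> irreducible_parabolic m sigma Q ->
  (forall n, standard_parabolic sigma (conj_set P (zeta sigma Q ^+ n))) ->
  adjacent sigma P Q.
Proof.
move=> [Y PE] [X [h [Xconn QE]]] stdP; set a := zeta sigma Q in stdP *.
have [exZ|nZ] := pselect (exists z, subgroup_center Q = generated_by [set z] /\
                  exists h, positive sigma (z ^ h)); last first.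
  (* Without a candidate, [zeta] takes its default value 1, which commutes with everything. *)
  have a1 : a = 1 by apply: xgetPN => z Zz; apply: nZ; exists z.
  by rewrite /adjacent -/a a1; apply: commute1.
have [centQ [k posa]] := xgetPex 1 exZ; rewrite -/(zeta sigma Q) -/a in centQ posa.
have [a1|a1] := positive_height hrho posa; last first.
  by rewrite /adjacent -/a a1; apply: commute1.
have centa : subgroup_center Q a by rewrite centQ; apply: sub_gen_smallest.
(* Conjugating back by [h] places [a] in the center of a standard parabolic subgroup, where the
   quadratic relation is available. *)
rewrite QE conj_subgroup_center in centa; case/conj_setE: centa => Xa Xcent.
have ha1 : (1 < height rho (a ^ h^-1))%R by rewrite (heightJ hrho).
have cent s : s \in X -> commute (a ^ h^-1) (sigma s).
  by move=> sX; apply: Xcent (sigma s) (sigma_in_parabolic sX).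
have [b [quad bn]] := commuting_element_quadratic hm hrho h Xconn Xa cent ha1.
rewrite conjgKV in quad; rewrite PE in stdP.
rewrite /adjacent -/a PE; apply: (zeta_fixed hrho).
exact: standard_orbit_fixed quad bn stdP.
Qed.

End CanonicalReductionSystem.

Theorem theorem29 (S : finType) (m : S -> S -> nat) (G : groupType)
    (sigma : S -> G) (hG : artin_tits_spherical m sigma)
    (alpha gamma : G) (hgamma : exists c : G, gamma = alpha ^ c)
    (hCRS : standard_family sigma (CRS m sigma gamma))
    (P : set G) (hPstd : standard_parabolic sigma P)
    (hPred : reduction_subgroup m sigma gamma P) :
  CRS m sigma gamma P <->
  (forall z : G,
     (\bigcup_(n in [set n : nat | (1 <= n)%N]) centralizer (gamma ^+ n)) z ->
     standard_parabolic sigma (conj_set P z)).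
Proof.
have [hm _ hpres] := hG; have [rho hrho] := burau_rep_exists hm hpres.
split=> [CP z [n /= n0 zn]|stdP].
  by apply: hCRS; apply: (CRS_conj hrho n0 _ CP).
have [pP gP] := reduction_subgroup_periodic hPred.
apply/(CRS_periodicP hrho); split=> // Q [iQ _ _] /finite_orbitP[k k0 kQ].
apply: (standard_orbit_adjacent hm hrho) => // n; apply: stdP.
(* [gamma ^+ k] fixes [Q], hence commutes with [zeta sigma Q] and with all its powers. *)
exists k => //; apply/commute_sym/commuteX/commute_sym.
exact: zeta_fixed hrho _ _ kQ.
Qed.
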